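(* Let $n\ge3$, let $(c_u)_{u\in\mathbb Z}$ be the quiddity of a triangulation $\mathbb T$ of an $n$-gon, and let $\{\zeta_{k,\ell}\}$ be the $q$-deformed Conway--Coxeter frieze of $\mathbb T$. Let $i,j\in\mathbb Z$ with $i\le j\le i+n-2$, and write $$M_q(c_i,c_{i+1},\dots,c_j)=\begin{pmatrix}\mathcal R&-q^{c_j-1}\mathcal R'\\ \mathcal S&-q^{c_j-1}\mathcal S'\end{pmatrix}.$$ Then: (1) $$\begin{pmatrix}\zeta_{i-1,j+1}&\zeta_{i-1,j}\\ \zeta_{i,j+1}&\zeta_{i,j}\end{pmatrix}=\begin{pmatrix}\mathcal R&\mathcal R'\\ \mathcal S&\mathcal S'\end{pmatrix},$$ where $\zeta_{i,j}=\zeta_{i,i}=\mathcal S'=0$ if $j=i$, $\zeta_{i-1,j+1}=\zeta_{i-1,i+n-1}=\mathcal R=0$ if $j=i+n-2$, and otherwise $\mathcal R',\mathcal S',\mathcal R,\mathcal S$ are nonzero polynomials. (2) $[[c_i,\dots,c_{j-1}]]_q=\dfrac{\mathcal R'}{\mathcal S'}$ and $[[c_i,\dots,c_{j-1},c_j]]_q=\dfrac{\mathcal R}{\mathcal S}$, where for $j=i$ the first (empty) continued fraction is $[[\ ]]_q=\dfrac10$.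
   Context: Triangulations. Let $n\ge3$ and let $\mathcal P$ be a convex $n$-gon with vertices numbered clockwise $v_0,\dots,v_{n-1}$; indices are extended to $\mathbb Z$ by $v_{u+n}=v_u$. A triangulation $\mathbb T$ of $\mathcal P$ is by $n-3$ non-crossing diagonals; its triangles are called cells. Let $c_u$ be the number of cells having $v_u$ as a vertex; the $n$-periodic sequence $(c_u)_{u\in\mathbb Z}$ is the quiddity of $\mathbb T$. For an integer $a\ge0$ put $[a]_q=1+q+\cdots+q^{a-1}$ (with $[0]_q=0$). $q$-deformed Conway--Coxeter frieze of $\mathbb T$: the array $\zeta_{k,\ell}$, for integers $k,\ell$ with $0\le\ell-k\le n+1$, determined by $\zeta_{k,k}=0$, $\zeta_{k,k+1}=1$, $\zeta_{k,k+2}=[c_{k+1}]_q$ and, recursively for $\ell-k\ge3$, by solving for $\zeta_{k,\ell}$ in the $q$-unimodular rule $$\zeta_{k,\ell-1}\zeta_{k+1,\ell}-\zeta_{k+1,\ell-1}\zeta_{k,\ell}=q^{\sum_{u=k+1}^{\ell-2}(c_u-1)}.$$ (That the divisors $\zeta_{k+1,\ell-1}$ needed here are nonzero, and that the entries are polynomials in $\mathbb Z[q]$, is part of what the proposition establishes.) Matrices: $$M_q(c_i,\dots,c_j)=\begin{pmatrix}[c_i]_q&-q^{c_i-1}\\1&0\end{pmatrix}\begin{pmatrix}[c_{i+1}]_q&-q^{c_{i+1}-1}\\1&0\end{pmatrix}\cdots\begin{pmatrix}[c_j]_q&-q^{c_j-1}\\1&0\end{pmatrix}.$$ $q$-deformed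 negative continued fractions, with values in $\mathbb P^1(\mathbb Q(q))=\mathbb Q(q)\cup\{\tfrac10\}$: $[[\ ]]_q=\tfrac10$, $[[c_j]]_q=[c_j]_q$, and $$[[c_i,\dots,c_j]]_q=[c_i]_q-\frac{q^{c_i-1}}{[[c_{i+1},\dots,c_j]]_q}\qquad(i<j).$$ *)

(* Defs.v *)
From HB Require Import structures.
From mathcomp Require Import all_boot all_order all_algebra.
From mathcomp Require Import zify.

Set Implicit Arguments.
Unset Strict Implicit.
Unset Printing Implicit Defensive.

Import Order.TTheory GRing.Theory Num.Theory.
Local Open Scope ring_scope.

(* The vertices v_0, ..., v_(n-1) of the convex n-gon are the elements of 'I_n,
   in (clockwise) order. The segment joining v_a and v_b, a < b, is the pair
   (a, b). *)

Definition is_side (n : nat) (a b : 'I_n) : bool :=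
  (b == a.+1 :> nat) || ((a == 0 :> nat) && (b == n.-1 :> nat)).

Definition is_diagonal (n : nat) (d : 'I_n * 'I_n) : bool :=
  (d.1 < d.2)%N && ~~ is_side d.1 d.2.

(* By convexity, two segments meet in their relative interiors iff their
   endpoints strictly alternate around the polygon; to be used in both orders. *)
Definition interleave (n : nat) (d e : 'I_n * 'I_n) : bool :=
  [&& d.1 < e.1, e.1 < d.2 & d.2 < e.2]%N.

Definition is_triangulation (n : nat) (T : {set 'I_n * 'I_n}) : Prop :=
  [/\ forall d, d \in T -> is_diagonal d,
      forall d e, d \in T -> e \in T -> ~~ interleave d e
    & #|T| = (n - 3)%N].

(* The triangles of T: the triples of vertices whose three sides are sides of
   the polygon or diagonals of T. No vertex of a convex polygon lies inside
   such a triangle, so no diagonal of T subdivides it. *)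
Definition cells (n : nat) (T : {set 'I_n * 'I_n}) : {set {set 'I_n}} :=
  [set A : {set 'I_n} | (#|A| == 3%N)
     && [forall a in A, forall b in A,
           (a < b)%N ==> is_side a b || ((a, b) \in T)]].

(* c_u, for u in Z; the congruence implements v_(u+n) = v_u. *)
Definition quiddity (n : nat) (T : {set 'I_n * 'I_n}) (u : int) : nat :=
  #|[set A in cells T | [exists v in A, (v%:Z == u %[mod n%:Z])%Z]]|.

Definition qint (a : nat) : {poly int} := \sum_(m < a) 'X^m.

Notation Qq := {fraction {poly rat}}.

Definition toQq (p : {poly int}) : Qq :=
  tofrac (map_poly (intr : int -> rat) p).

Section Frieze.

Variable c : int -> nat.

(* frieze_row d k is zeta_(k, k+d). For d >= 3 the q-unimodular rule is solved
   for zeta_(k, k+d) by division in Q(q), where x / 0 = 0. The values of a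
   quiddity are positive, so the predecessors are not truncated. *)
Fixpoint frieze_row (d : nat) (k : int) : Qq :=
  match d with
  | 0 => 0
  | d1.+1 =>
    match d1 with
    | 0 => 1
    | d2.+1 =>
      match d2 with
      | 0 => toQq (qint (c (k + 1)))
      | _.+1 =>
        (frieze_row d1 k * frieze_row d1 (k + 1)
           - toQq 'X^(\sum_(m < d2) (c (k + 1 + m%:Z)%R).-1))
        / frieze_row d2 (k + 1)
      end
    end
  end.

(* Meaningful for k <= l only. *)
Definition zeta (k l : int) : Qq :=
  match l - k with
  | Posz d => frieze_row d k
  | Negz _ => 0
  end.

(* c_i, ..., c_j, for i - 1 <= j; empty if j = i - 1. *)
Definition window (i j : int) : seq nat :=
  mkseq (fun m => c (i + m%:Z)%R) `|(j - i + 1)%R|%N.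

End Frieze.

Definition mat2 (A : Type) (x y z t : A) : 'M[A]_2 :=
  \matrix_(a < 2, b < 2)
    if a == 0 then (if b == 0 then x else y) else (if b == 0 then z else t).

Definition Mq (s : seq nat) : 'M[{poly int}]_2 :=
  \prod_(a <- s) mat2 (qint a) (- 'X^(a.-1)) 1 0.

(* P^1(Q(q)) is Q(q) together with the point 1/0, which is None. *)
Definition P1 := option Qq.

(* x / y in P^1, for (x, y) != (0, 0). *)
Definition P1_ratio (x y : Qq) : P1 := if y == 0 then None else Some (x / y).

(* x - y / z in P^1, for x, y in Q(q) with y != 0 and z in P^1. *)
Definition P1_sub_div (x y : Qq) (z : P1) : P1 :=
  match z with
  | None => Some x
  | Some w => if w == 0 then None else Some (x - y / w)
  end.

Fixpoint qcf (s : seq nat) : P1 :=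
  match s with
  | [::] => None
  | [:: a] => Some (toQq (qint a))
  | a :: s' => P1_sub_div (toQq (qint a)) (toQq 'X^(a.-1)) (qcf s')
  end.

(* Wherever the divisor does not vanish, zeta satisfies the q-unimodular rule. *)
Lemma zeta_unimodular (c : int -> nat) (k : int) (d : nat) :
  let l := k + d.+3%:Z in
  zeta c (k + 1) (l - 1) != 0 ->
  zeta c k (l - 1) * zeta c (k + 1) l - zeta c (k + 1) (l - 1) * zeta c k l
    = toQq 'X^(\sum_(m < d.+1) (c (k + 1 + m%:Z)%R).-1).
Proof.
move=> l.
have e1 : l - (k + 1) = d.+2%:Z by rewrite /l; lia.
have e2 : l - 1 - (k + 1) = d.+1%:Z by rewrite /l; lia.
have e3 : l - 1 - k = d.+2%:Z by rewrite /l; lia.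
have e4 : l - k = d.+3%:Z by rewrite /l; lia.
rewrite /zeta e1 e2 e3 e4 => nz.
have -> : frieze_row c d.+3 k =
    (frieze_row c d.+2 k * frieze_row c d.+2 (k + 1)
       - toQq 'X^(\sum_(m < d.+1) (c (k + 1 + m%:Z)%R).-1))
    / frieze_row c d.+1 (k + 1) by [].
by rewrite mulrCA divff // mulr1 opprB addrC subrK.
Qed.

(* Main.v *)
Require Import Defs.
From HB Require Import structures.
From mathcomp Require Import all_boot all_order all_algebra.
From mathcomp Require Import zify ring.

Set Implicit Arguments.
Unset Strict Implicit.
Unset Printing Implicit Defensive.

Import Order.TTheory GRing.Theory Num.Theory.
Local Open Scope ring_scope.

(* A noncrossing set of n - 3 diagonals is maximal, so every side or diagonal
   (a, b) bounds a triangle (a, m, b), which splits the polygon cut off by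
   (a, b) into those cut off by (a, m) and (m, b). Two facts propagate through
   this recursion: the product of the n matrices attached to the quiddity is
   scalar over Q(q), and at q = 1 the recurrence of the quiddity has a solution
   that is positive on 0, ..., n - 1. The frieze entries are the continuants,
   i.e. the entries of partial products of the matrices, as soon as those of
   length 1, ..., n - 1 do not vanish. Comparison with the positive solution
   shows this for windows not passing from n - 1 to 0; since the full product is
   scalar, complementary windows have products inverse to each other up to a
   factor, which transfers it to the other windows and makes the continuants of
   length n vanish. *)

(** * Sides and diagonals; the bound n - 3 on noncrossing diagonals *)

Section Edges.
Local Open Scope nat_scope.

Variables (n : nat) (T : {set 'I_n * 'I_n}).

Definition edge (a b : nat) : bool :=
  (a < b < n) && [|| b == a.+1, (a == 0) && (b == n.-1)
    | [exists d in T, (d.1 == a :> nat) && (d.2 == b :> nat)]].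

(** The farthest neighbour of [a] before [b]: by noncrossing, the only candidate for an apex between
    them of a triangle on (a, b). *)
Definition third (a b : nat) : nat := \max_(m < b | edge a m) m.

Lemma edge_ord (a b : 'I_n) :
  edge a b = (a < b) && (is_side a b || ((a, b) \in T)).
Proof.
rewrite /edge /is_side ltn_ord andbT -orbA; congr (_ && [|| _, _ | _]).
apply/existsP/idP => [[[x y]] /= /and3P[xyT /eqP xa /eqP yb]|abT].
  by rewrite -(ord_inj xa) -(ord_inj yb).
by exists (a, b); rewrite abT /= !eqxx.
Qed.

Lemma edge_ltn a b : edge a b -> a < b.
Proof. by case/andP=> /andP[]. Qed.

Lemma edge_bound a b : edge a b -> b < n.
Proof. by case/andP=> /andP[]. Qed.

Lemma edgeS a : a.+1 < n -> edge a a.+1.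
Proof. by move=> an; rewrite /edge an leqnn eqxx. Qed.

Lemma edge0 : 1 < n -> edge 0 n.-1.
Proof. by move=> n1; rewrite /edge !eqxx /= orbT andbT; lia. Qed.

Lemma thirdP a b : a.+1 < b -> b < n -> edge a (third a b) /\ third a b < b.
Proof.
move=> ab bn; rewrite /third.
have e1 : edge a (Ordinal ab) by rewrite /= edgeS //; lia.
by rewrite (bigop.bigmax_eq_arg (Ordinal ab)) //; case: arg_maxnP => // i ei _.
Qed.

Lemma third_max a b m : m < b -> edge a m -> m <= third a b.
Proof. by move=> mb e; rewrite (@leq_bigmax_cond _ _ _ (Ordinal mb)). Qed.

Hypothesis noncrossing : forall d e, d \in T -> e \in T -> ~~ interleave d e.

Lemma edge_noncrossing a b x y :
  edge a b -> edge x y -> a < x -> x < b -> b < y -> False.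
Proof.
rewrite /edge => /andP[/andP[ab bn] /or3P[|/andP[]|/existsP[d /and3P[dT /eqP da /eqP db]]]];
  try lia.
move=> /andP[/andP[xy yn] /or3P[|/andP[]|/existsP[e /and3P[eT /eqP ex /eqP ey]]]];
  try lia.
move=> ax xb b_y.
by have := noncrossing dT eT; rewrite /interleave da db ex ey ax xb b_y.
Qed.

Hypothesis diagonals : forall d, d \in T -> is_diagonal d.

(* A diagonal or the closing side (0, n-1) is determined by the apex of the
   triangle hanging from it, and the possible apices are 1, ..., n-2. *)
Lemma noncrossing_card : 3 <= n -> #|T| <= n - 3.
Proof.
move=> hn; have h0 : 0 < n by lia.
have h1 : n.-1 < n by lia.
pose d0 := (Ordinal h0, Ordinal h1).
have d0T : d0 \notin T.
  by apply/negP => /diagonals /andP[_]; rewrite /is_side /= !eqxx /= orbT.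
have dE d : d \in d0 |: T -> edge d.1 d.2 /\ d.1.+1 < d.2.
  rewrite !inE => /orP[/eqP->|dT]; first by split; [apply: edge0|]; rewrite /=; lia.
  have /andP[lt nside] := diagonals dT; split.
    by rewrite edge_ord lt -surjective_pairing dT orbT.
  by move: nside; rewrite negb_or => /andP[ns _]; rewrite ltn_neqAle eq_sym ns.
have inj : {in enum (d0 |: T) &, injective (fun d : 'I_n * 'I_n => third d.1 d.2)}.
  (* With a common apex m and e.1 < d.1, the edge (e.1, m) would cross [d], as e.1 < d.1 < m <
     d.2. *)
  have wlog_inj (d e : 'I_n * 'I_n) : d \in d0 |: T -> e \in d0 |: T ->
      third d.1 d.2 = third e.1 e.2 -> e.1 < d.1 -> False.
    move=> /dE[ed sd] /dE[ee se] eq lt.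
    have [ed' ltd] := thirdP sd (ltn_ord _).
    have [ee' lte] := thirdP se (ltn_ord _).
    apply: (edge_noncrossing ee' ed lt); rewrite -eq //.
    exact: edge_ltn ed'.
  move=> d e; rewrite !mem_enum => dT eT /= eq.
  case: (ltngtP d.1 e.1) => [lt|lt|e1].
  - by case: (wlog_inj e d).
  - by case: (wlog_inj d e).
  have [[ed sd] [ee se]] := (dE _ dT, dE _ eT).
  have [_ ltd] := thirdP sd (ltn_ord _).
  have [_ lte] := thirdP se (ltn_ord _).
  (* With a common left end, the smaller right end is a neighbour below the larger one, so by
     maximality it is at most the common apex, which lies strictly below it. *)
  case: (ltngtP d.2 e.2) => [lt|lt|e2].
  - by rewrite e1 in ed; have := third_max lt ed; rewrite -eq leqNgt ltd.
  - by rewrite -e1 in ee; have := third_max lt ee; rewrite eq leqNgt lte.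
  by case: d e e1 e2 {dT eT eq ed sd ee se ltd lte} => [d1 d2] [e1 e2] /= /ord_inj-> /ord_inj->.
have := @uniq_leq_size _
  (map (fun d : 'I_n * 'I_n => third d.1 d.2) (enum (d0 |: T))) (iota 1 (n - 2)).
rewrite map_inj_in_uniq // enum_uniq size_map size_iota -cardE cardsU1 d0T.
move=> /(_ isT) H; suff: 1 + #|T| <= n - 2 by lia.
apply: H => m /mapP[[x y]]; rewrite mem_enum => /dE[/= _ sd] ->.
have [e lt] := thirdP sd (ltn_ord y).
by rewrite mem_iota; have := edge_ltn e; have := ltn_ord y; lia.
Qed.

End Edges.

(** * Cells, and the splitting of the polygon cut off by an edge *)

Section Cells.
Local Open Scope nat_scope.

Variables (n : nat) (T : {set 'I_n * 'I_n}).
Definition cells_in (a b : nat) : {set {set 'I_n}} :=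
  [set A in cells T | [forall v in A, a <= v <= b]].

Definition on_cell (u : nat) (A : {set 'I_n}) : bool :=
  [exists v in A, v == u :> nat].

(** When (a, b) is an edge, this is the quiddity at [u] of the subpolygon on the vertices a, ...,
    b. *)
Definition cell_count (a b u : nat) : nat :=
  \sum_(A in cells_in a b) on_cell u A.

Lemma cells_edge A (x y : 'I_n) :
  A \in cells T -> x \in A -> y \in A -> x < y -> edge T x y.
Proof.
rewrite inE => /andP[_ /forall_inP H] xA yA xy; rewrite edge_ord xy /=.
by have /forall_inP/(_ _ yA) := H _ xA; rewrite xy.
Qed.

Lemma cell_count_out a b u : ~~ (a <= u <= b) -> cell_count a b u = 0.
Proof.
move=> nu; apply: big1 => A; rewrite inE => /andP[_ /forall_inP H].
apply/eqP; rewrite eqb0; apply/exists_inPn => v vA.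
by apply: contraNneq nu => <-; apply: H.
Qed.

Lemma cells_in_card a b A : A \in cells_in a b -> 2 <= b - a.
Proof.
rewrite !inE => /andP[/andP[/eqP cA _] /forall_inP H].
have := @uniq_leq_size _ (map val (enum A)) (iota a (b.+1 - a)).
rewrite map_inj_uniq; last exact: val_inj.
rewrite enum_uniq size_map size_iota -cardE cA => /(_ isT) => K.
suff: 3 <= b.+1 - a by lia.
apply: K => v /mapP[w]; rewrite mem_enum => /H wab ->.
by rewrite mem_iota /=; lia.
Qed.

Lemma cell_countS a u : cell_count a a.+1 u = 0.
Proof. by apply: big1 => A /cells_in_card; lia. Qed.

Hypotheses (hn : 3 <= n) (hT : is_triangulation T).

Let noncr : forall d e, d \in T -> e \in T -> ~~ interleave d e.
Proof. by case: hT. Qed.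

(** Take m = [third T a b]. If (m, b) were not an edge, it would cross no diagonal of [T], and
    adding it would violate [noncrossing_card]. *)
Lemma edge_apex a b : edge T a b -> a.+1 < b ->
  exists m, [/\ a < m, m < b, edge T a m & edge T m b].
Proof.
move=> eab ab; have bn := edge_bound eab.
have [eam mb] := thirdP T ab bn; set m := third T a b in eam mb *.
have am := edge_ltn eam; exists m; split=> //.
apply: contraT => nmb; have mn := ltn_trans mb bn.
pose d : 'I_n * 'I_n := (Ordinal mn, Ordinal bn).
move: nmb; rewrite (edge_ord T (Ordinal mn) (Ordinal bn)) /= mb /= negb_or.
rewrite -/d => /andP[nside dT].
(* An [e] crossing (m, b) crosses (a, b) or (a, m), unless it starts at [a] and ends between m and
   b, against the maximality of m. *)
have cross (e : 'I_n * 'I_n) : e \in T -> ~~ interleave d e && ~~ interleave e d.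
  move=> eT; have ee : edge T e.1 e.2.
    case: hT => /(_ _ eT) /andP[lt _] _ _.
    by rewrite edge_ord lt -surjective_pairing eT orbT.
  apply/andP; split; apply/negP => /and3P[/= h1 h2 h3].
    by apply: (edge_noncrossing noncr eab ee) => //; apply: ltn_trans h1.
  case: (ltngtP e.1 a) => ea.
  - by apply: (edge_noncrossing noncr ee eab) => //; lia.
  - exact: (edge_noncrossing noncr eam ee).
  by move: ee; rewrite ea => /(third_max h3); rewrite -/m; lia.
have := @noncrossing_card n (d |: T) _ _ hn.
case: hT => diag _ cardT; rewrite cardsU1 dT cardT => H.
suff: 1 + (n - 3) <= n - 3 by lia.
apply: H => [x y|x]; rewrite !inE.
  case/orP=> [/eqP->|xT]; case/orP=> [/eqP->|yT].
  - by rewrite /interleave ltnn.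
  - by case/andP: (cross _ yT).
  - by case/andP: (cross _ xT).
  - exact: noncr.
case/orP=> [/eqP->|]; last exact: diag.
by rewrite /is_diagonal mb.
Qed.

(** A cell in neither part has vertices x < m < z; as (x, z) crosses neither (a, m) nor (m, b), x =
    a and z = b. Its third vertex is then m. *)
Lemma cells_in_glue (a m b : 'I_n) :
  edge T a b -> edge T a m -> edge T m b ->
  cells_in a b = [set a; m; b] |: (cells_in a m :|: cells_in m b).
Proof.
move=> eab eam emb; have [am mb] := (edge_ltn eam, edge_ltn emb).
have ab := ltn_trans am mb.
have ne : [&& a != m, a != b & m != b].
  by rewrite -!val_eqE /=; lia.
have [am' ab' mb'] := and3P ne.
have c3 : #|[set a; m; b]| = 3.
  by rewrite -setUA cardsU1 cards2 !inE negb_or am' ab' mb'.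
apply/setP => A; rewrite !inE; apply/idP/idP.
  case/andP=> cA /forall_inP inA.
  case: (boolP [forall v in A, a <= v <= m]) => [_|/forall_inPn[z zA zm]].
    by rewrite cA orbT.
  case: (boolP [forall v in A, m <= v <= b]) => [_|/forall_inPn[x xA xm]].
    by rewrite cA !orbT.
  suff -> : A = [set a; m; b] by rewrite eqxx.
  have [az zb] := andP (inA _ zA); have [ax xb] := andP (inA _ xA).
  rewrite az -ltnNge in zm; rewrite xb andbT -ltnNge in xm.
  have cA' : A \in cells T by rewrite inE.
  have exz := cells_edge cA' xA zA (ltn_trans xm zm).
  have xa : x = a.
    apply: val_inj => /=; apply/eqP; rewrite eqn_leq ax andbT leqNgt; apply/negP=> lt.
    exact: (edge_noncrossing noncr eam exz).
  have zb' : z = b.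
    apply: val_inj => /=; apply/eqP; rewrite eqn_leq zb leqNgt; apply/negP=> lt.
    exact: (edge_noncrossing noncr exz emb).
  subst x z.
  (* A vertex strictly between a and m would give an edge to b crossing (a, m); symmetrically
     between m and b. *)
  have : A \subset [set a; m; b].
    apply/subsetP => y yA; rewrite !inE; have [ay yb] := andP (inA _ yA).
    case: (ltngtP y m) => [ym|my|/val_inj->]; last by rewrite eqxx orbT.
      have [->|nya] := eqVneq y a; first by [].
      have eyb := cells_edge cA' yA zA (ltn_trans ym mb).
      case: (edge_noncrossing noncr eam eyb) => //.
      by rewrite ltn_neqAle ay andbT eq_sym.
    have [->|nyb] := eqVneq y b; first by rewrite orbT.
    have eay := cells_edge cA' xA yA (ltn_trans am my).
    case: (edge_noncrossing noncr eay emb) => //.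
    by rewrite ltn_neqAle yb andbT.
  move=> sA; apply/eqP; rewrite eqEcard sA c3.
  by case/andP: cA => /eqP->.
case/or3P=> [/eqP->|/andP[cA /forall_inP inA]|/andP[cA /forall_inP inA]].
- rewrite c3 eqxx /=; apply/andP; split.
    apply/forall_inP => x; rewrite !inE => hx; apply/forall_inP => y; rewrite !inE => hy.
    apply/implyP => xy; suff : edge T x y by rewrite edge_ord => /andP[].
    move: xy; case/orP: hx => [/orP[]|] /eqP->; case/orP: hy => [/orP[]|] /eqP-> //;
      by move=> lt; exfalso; lia.
  by apply/forall_inP => x; rewrite !inE => /orP[/orP[]|] /eqP->; lia.
- rewrite cA /=; apply/forall_inP => v /inA; lia.
- rewrite cA /=; apply/forall_inP => v /inA; lia.
Qed.

Lemma cell_count_glue a m b u :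
  edge T a b -> edge T a m -> edge T m b ->
  cell_count a b u =
    ((u == a) + (u == m) + (u == b)) + (cell_count a m u + cell_count m b u).
Proof.
move=> eab eam emb; have [am mb] := (edge_ltn eam, edge_ltn emb).
have bn := edge_bound emb.
have mn := ltn_trans mb bn; have an := ltn_trans am mn.
rewrite /cell_count.
rewrite (@cells_in_glue (Ordinal an) (Ordinal mn) (Ordinal bn)) //=.
rewrite big_setU1 /=; last first.
  rewrite !inE; apply/negP; case/orP=> /andP[_ /forall_inP H].
    by have := H (Ordinal bn); rewrite !inE eqxx orbT => /(_ isT) /=; lia.
  by have := H (Ordinal an); rewrite !inE eqxx => /(_ isT) /=; lia.
congr (_ + _); last first.
  rewrite (eq_bigl [predU cells_in a m & cells_in m b]); last by move=> A; rewrite inE.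
  rewrite bigU //= disjoints_subset; apply/subsetP => A; rewrite !inE.
  case/andP=> cA /forall_inP H; rewrite cA /=; apply/negP => /forall_inP H'.
  (* A cell in both parts would have all its vertices equal to m. *)
  have : A \in cells_in m m.
    rewrite inE [A \in _]inE cA /=; apply/forall_inP => v vA.
    by have := H _ vA; have := H' _ vA; lia.
  by move/cells_in_card; rewrite subnn.
have -> : on_cell u [set Ordinal an; Ordinal mn; Ordinal bn]
    = [|| u == a, u == m | u == b].
  apply/exists_inP/idP => [[v]|].
    by rewrite !inE => /orP[/orP[]|] /eqP-> /eqP /= ->; rewrite eqxx ?orbT.
  case/or3P=> /eqP->; [exists (Ordinal an)|exists (Ordinal mn)|exists (Ordinal bn)];
    by rewrite ?inE ?eqxx ?orbT.
lia.
Qed.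

(** Recursion on the apices. Of the geometry, the gluing step receives only the order of the
    vertices and the relation between the counts; the base case is a single edge, with no cells. *)
Lemma edge_ind (P : nat -> nat -> Prop) :
  (forall a, P a a.+1) ->
  (forall a m b, a < m -> m < b ->
     (forall u, cell_count a b u =
        ((u == a) + (u == m) + (u == b)) + (cell_count a m u + cell_count m b u)) ->
     P a m -> P m b -> P a b) ->
  forall a b, edge T a b -> P a b.
Proof.
move=> base glue a b; have [k] := ubnP (b - a).
elim: k a b => // k IH a b hk eab.
have ab := edge_ltn eab.
case: (ltngtP a.+1 b) => [ab1||<-]; [|lia|exact: base].
have [m [am mb eam emb]] := edge_apex eab ab1.
apply: (glue a m b am mb) => [u||]; first exact: cell_count_glue.
  by apply: IH => //; lia.
by apply: IH => //; lia.
Qed.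

(** The closing side (0, n - 1) cuts off the whole polygon, which transfers statements on edges to
    the quiddity. *)
Lemma quiddity_cell_count (u : nat) :
  u < n -> quiddity T u%:Z = cell_count 0 n.-1 u.
Proof.
move=> un; rewrite /quiddity /cell_count.
have -> : cells_in 0 n.-1 = cells T.
  apply/setP => A; rewrite inE; apply/andb_idr => _.
  by apply/forall_inP => v _; have := ltn_ord v; lia.
rewrite -sum1_card big_mkcond [RHS]big_mkcond /=; apply: eq_bigr => A _.
rewrite inE; case: (A \in cells T) => //=.
rewrite (_ : [exists v in A, _] = on_cell u A); first by case: (on_cell u A).
apply: eq_existsb => v; congr (_ && _).
by rewrite !modz_nat eqz_nat !modn_small.
Qed.

Lemma cell_count_gt0 a b : edge T a b -> a.+1 < b ->
  forall u, a <= u <= b -> 0 < cell_count a b u.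
Proof.
move: a b; apply: edge_ind => [a|a m b am mb E IHam IHmb _ u uab].
  by rewrite ltnn.
rewrite E; case: (ltngtP u m) => [um|mu|_]; last by lia.
  case: (ltngtP a u) => [au||->]; [|lia|lia].
  by have := IHam (leq_ltn_trans au um) u; lia.
case: (ltngtP u b) => [ub||_]; [|lia|lia].
by have := IHmb (leq_ltn_trans mu ub) u; lia.
Qed.

End Cells.

(** * Two-by-two matrices by entries *)

Section Mat2.
Variable R : comNzRingType.
Implicit Types x y z t : R.

Lemma mat2_mul x y z t x' y' z' t' :
  mat2 x y z t * mat2 x' y' z' t' =
  mat2 (x * x' + y * z') (x * y' + y * t') (z * x' + t * z') (z * y' + t * t').
Proof.
apply/matrixP => a b; rewrite !mxE !big_ord_recl big_ord0 !mxE /= addr0.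
by case: a => [[|[|]]] //; case: b => [[|[|]]].
Qed.

Lemma mat2_scalar x : x%:M = mat2 x 0 0 x.
Proof.
apply/matrixP => a b; rewrite !mxE.
by case: a => [[|[|]]] //; case: b => [[|[|]]].
Qed.

End Mat2.

Lemma map_mat2 (A B : Type) (f : A -> B) x y z t :
  map_mx f (mat2 x y z t) = mat2 (f x) (f y) (f z) (f t).
Proof. by apply/matrixP => a b; rewrite !mxE; do 2 case: ifP. Qed.

Lemma mat2_inj (A : Type) (x y z t x' y' z' t' : A) :
  mat2 x y z t = mat2 x' y' z' t' -> [/\ x = x', y = y', z = z' & t = t'].
Proof.
move=> /matrixP E.
by split; [have := E 0 0|have := E 0 1|have := E 1 0|have := E 1 1]; rewrite !mxE.
Qed.

(** * Scalar matrix products under gluing of polygons *)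

Section Monodromy.

Variables (F : fieldType) (q : F).
Hypothesis q0 : q != 0.

(* For a > 0 this is the matrix of the q-continued fraction; dividing by q lets
   it make sense at a = 0, where it describes a degenerate two-sided polygon. *)
Definition qmat (a : nat) : 'M[F]_2 :=
  mat2 (\sum_(m < a) q ^+ m) (- (q ^+ a / q)) 1 0.

(** Left multiplication by [U] raises the index of [qmat] by one, and [V] is inverse to [qmat 0]. *)
Let U : 'M[F]_2 := mat2 q 1 0 1.
Let V : 'M[F]_2 := mat2 0 1 (- q) 0.

Lemma qmatE a : qmat a = U ^+ a * qmat 0.
Proof.
elim: a => [|a IH]; first by rewrite expr0 mul1r.
rewrite exprS -mulrA -IH mat2_mul; congr mat2; rewrite ?exprS; try ring.
rewrite big_ord_recl mulr_sumr addrC mulr1; congr (_ + _).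
by apply: eq_bigr => m _; rewrite exprS.
Qed.

(* Two polygons are glued onto a triangle along (a, m) and (m, b): the counts at
   a and b grow by 1, the count at m becomes y + y' + 1. *)
Lemma qmat_glue x y y' z (A B : 'M[F]_2) (s t : F) :
  qmat x * A * qmat y = s%:M -> qmat y' * B * qmat z = t%:M ->
  qmat x.+1 * A * qmat (y + y').+1 * B * qmat z.+1 = (- (q ^+ 2 * s * t))%:M.
Proof.
have JV : qmat 0 * V = 1.
  rewrite mat2_mul -idmxE mat2_scalar big_ord0 expr0.
  by congr mat2; field.
rewrite !(qmatE x, qmatE y, qmatE y', qmatE z) => H1 H2.
have H1' : U ^+ x * qmat 0 * A * U ^+ y = s%:M * V.
  by rewrite -H1 -!mulrA JV mulr1.
have H2' : U ^+ y' * qmat 0 * B * U ^+ z = t%:M * V.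
  by rewrite -H2 -!mulrA JV mulr1.
rewrite (qmatE x.+1) (qmatE z.+1) (qmatE (y + y').+1).
rewrite exprS -addnS exprD exprS exprSr.
(* Here A and B are absorbed into s and t; what is left is that U V U V U [qmat 0] is the scalar
   -q^2. *)
transitivity (U * (s%:M * V) * U * (t%:M * V) * U * qmat 0).
  by rewrite -H1' -H2' !mulrA.
rewrite !mat2_scalar !mat2_mul big_ord0 expr0.
by congr mat2; field.
Qed.

End Monodromy.

(** * Monodromy and positive labels by recursion over the triangulation *)

Section Triangulation.

Variables (n : nat) (T : {set 'I_n * 'I_n}).
Hypotheses (hn : (3 <= n)%N) (hT : is_triangulation T).

Local Notation cc := (cell_count T).

(** A q-analogue of the Conway-Coxeter relation, in which the product is minus the identity. *)
Lemma monodromy_scalar (F : fieldType) (q : F) : q != 0 ->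
  forall a b, edge T a b ->
  exists2 s : F, s != 0 &
    qmat q (cc a b a) * (\prod_(a.+1 <= u < b) qmat q (cc a b u))
      * qmat q (cc a b b) = s%:M.
Proof.
move=> q0; apply: (edge_ind hn hT) => [a|a m b am mb E [s s0 Hs] [t t0 Ht]].
  (* A single edge is a two-sided polygon with both counts 0, and [qmat q 0] squares to -1/q. *)
  exists (- q^-1); first by rewrite oppr_eq0 invr_eq0.
  rewrite !cell_countS big_geq // mulr1 mat2_mul mat2_scalar big_ord0 expr0.
  by congr mat2; field.
exists (- (q ^+ 2 * s * t)); first by rewrite oppr_eq0 !mulf_neq0 ?expf_neq0.
rewrite -(qmat_glue q0 Hs Ht) (@big_cat_nat _ _ _ m) //=; last exact: ltnW.
rewrite (@big_ltn _ _ _ m b) // !mulrA.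
rewrite (eq_big_nat _ _ (F2 := fun u => qmat q (cc a m u))); last first.
  move=> u um; rewrite E (cell_count_out T (a := m)); last by lia.
  by congr qmat; lia.
rewrite [X in _ * X * _](eq_big_nat _ _ (F2 := fun u => qmat q (cc m b u))); last first.
  move=> u um; rewrite E (cell_count_out T (b := m)); last by lia.
  by congr qmat; lia.
rewrite !E (cell_count_out T (a := m) (u := a)); last by lia.
rewrite (cell_count_out T (b := m) (u := b)); last by lia.
by congr (qmat q _ * _ * qmat q _ * _ * qmat q _); lia.
Qed.

(* Conway-Coxeter labels: the apex of a triangle gets the sum of the labels of
   its base. *)
Lemma positive_labels a b : edge T a b -> forall p r : int, 0 < p -> 0 < r ->
  exists f : nat -> int,
  [/\ f a = p /\ f b = r,
      f a.+1 = (cc a b a)%:Z * p + r /\ f b.-1 = (cc a b b)%:Z * r + p,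
      forall u, (a <= u <= b)%N -> 0 < f u
    & forall u, (a <= u)%N -> (u.+2 <= b)%N ->
        f u.+2 = (cc a b u.+1)%:Z * f u.+1 - f u].
Proof.
move: a b; apply: (edge_ind hn hT) => [a p r p0 r0|a m b am mb E IH1 IH2 p r p0 r0].
  exists (fun u => if u == a then p else r).
  rewrite !cell_countS !mul0r !add0r eqxx /= (_ : (a.+1 == a) = false); last by lia.
  split=> //; last by lia.
  by move=> u _; case: ifP.
have pr : 0 < p + r by lia.
have [f1 [[f1a f1m] [f1a' f1m'] f1gt0 f1rec]] := IH1 p (p + r) p0 pr.
have [f2 [[f2m f2b] [f2m' f2b'] f2gt0 f2rec]] := IH2 (p + r) r pr r0.
pose f u := if (u <= m)%N then f1 u else f2 u.
have fl u : (u <= m)%N -> f u = f1 u by rewrite /f => ->.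
have fr u : (m <= u)%N -> f u = f2 u.
  by rewrite /f leq_eqVlt => /orP[/eqP<-|]; [rewrite leqnn f1m | case: leqP].
have cl u : (a < u < m)%N -> cc a b u = cc a m u.
  by move=> um; rewrite E (cell_count_out T (a := m)); lia.
have cr u : (m < u < b)%N -> cc a b u = cc m b u.
  by move=> um; rewrite E (cell_count_out T (b := m)); lia.
have ca : cc a b a = (cc a m a).+1.
  by rewrite E (cell_count_out T (a := m)); lia.
have cb : cc a b b = (cc m b b).+1.
  by rewrite E (cell_count_out T (b := m)); lia.
have cm : cc a b m = (cc a m m + cc m b m).+1 by rewrite E; lia.
exists f; split.
- by rewrite fl 1?fr; lia.
- rewrite fl // fr; last by lia.
  by rewrite f1a' f2b' ca cb; split; ring.
- by move=> u uab; case: (leqP u m) => um; [rewrite fl ?f1gt0|rewrite fr ?f2gt0]; lia.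
move=> u au ub; case: (ltngtP u.+1 m) => [um|mu|eq].
- by rewrite !fl ?cl ?f1rec //; lia.
- by rewrite !fr ?cr ?f2rec //; lia.
(* At the apex the neighbouring labels are [cc a m m] (p + r) + p and [cc m b m] (p + r) + r; their
   sum has one extra p + r, matching the new triangle. *)
have uE : u = m.-1 by lia.
rewrite fr 1?fl; [|lia..].
rewrite fl; last by lia.
by rewrite eq f2m' uE f1m' f1m cm; ring.
Qed.

End Triangulation.

(** * The embedding of Z[q] into Q(q) *)

HB.instance Definition _ :=
  GRing.RMorphism.copy toQq (@tofrac {poly rat} \o map_poly (intr : int -> rat)).

Lemma toQq_eq0 p : (toQq p == 0) = (p == 0).
Proof.
rewrite tofrac_eq0; apply/eqP/eqP => [|->]; last exact: raddf0.
rewrite -(raddf0 (map_poly (intr : int -> rat))).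
by apply: map_inj_poly; [apply: intr_inj|].
Qed.

Lemma mkseqD (A : Type) (f : nat -> A) a b :
  mkseq f (a + b) = mkseq f a ++ mkseq (fun m => f (a + m)%N) b.
Proof.
by rewrite /mkseq iotaD map_cat add0n -[in iota a b](addn0 a) iotaDl -map_comp.
Qed.

(** * Continuants, and their relation to matrices, friezes and continued fractions *)

Section Continuants.

Variable c : int -> nat.

(* The frieze entry zeta_(k, k+d), by the recurrence on its last index; unlike
   the unimodular rule this needs no division. *)
Fixpoint continuant (d : nat) (k : int) : {poly int} :=
  match d with
  | 0 => 0
  | d1.+1 =>
    match d1 with
    | 0 => 1
    | d2.+1 => qint (c (k + d1%:Z)) * continuant d1 k
                 - 'X^((c (k + d2%:Z)).-1) * continuant d2 k
    end
  end.

Arguments continuant : simpl never.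

Lemma continuant0 k : continuant 0 k = 0. Proof. by []. Qed.
Lemma continuant1 k : continuant 1 k = 1. Proof. by []. Qed.

Lemma continuantSS d k :
  continuant d.+2 k = qint (c (k + d.+1%:Z)) * continuant d.+1 k
                        - 'X^((c (k + d%:Z)).-1) * continuant d k.
Proof. by []. Qed.

(** Needed because continued fractions unfold at their first coefficient, whereas [continuant]
    unfolds at the last. *)
Lemma continuant_recl d k :
  continuant d.+2 k = qint (c (k + 1)) * continuant d.+1 (k + 1)
                        - 'X^((c (k + 1)).-1) * continuant d (k + 2).
Proof.
have [m] := ubnP d; elim: m d => // m IH [|[|d]] hd.
- by rewrite continuantSS !continuant0 !mulr0 !subr0.
- rewrite !continuantSS !continuant0 !continuant1 !mulr0 !subr0 !mulr1 mulrC.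
  by congr (_ * qint (c _) - _); lia.
rewrite continuantSS !IH; [|lia..].
rewrite [continuant d.+3 _]continuantSS [continuant d.+2 (k + 2)]continuantSS.
have -> : k + 1 + d.+2%:Z = k + d.+3%:Z by lia.
have -> : k + 1 + d.+1%:Z = k + d.+2%:Z by lia.
have -> : k + 2 + d.+1%:Z = k + d.+3%:Z by lia.
have -> : k + 2 + d%:Z = k + d.+2%:Z by lia.
ring.
Qed.

(** A Wronskian of two solutions of one recurrence, started at k and k + 1: each step multiplies it
    by a power of q. *)
Lemma continuant_unimodular d k :
  continuant d.+1 k * continuant d.+1 (k + 1) - continuant d (k + 1) * continuant d.+2 k
    = 'X^(\sum_(m < d) (c (k + 1 + m%:Z)).-1).
Proof.
elim: d => [|d IH]; first by rewrite big_ord0 expr0 !continuant1 continuant0 mul0r subr0 mulr1.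
rewrite big_ord_recr /= exprD -IH.
rewrite [continuant d.+3 _]continuantSS [continuant d.+2 (k + 1)]continuantSS.
have -> : k + 1 + d.+1%:Z = k + d.+2%:Z by lia.
have -> : k + 1 + d%:Z = k + d.+1%:Z by lia.
ring.
Qed.

(** Multiplying on the right by one more matrix performs one step of the recurrence in both rows. *)
Lemma Mq_continuant d i :
  Mq (mkseq (fun m => c (i + m%:Z)) d.+1) =
  mat2 (continuant d.+2 (i - 1)) (- 'X^((c (i + d%:Z)).-1) * continuant d.+1 (i - 1))
       (continuant d.+1 i) (- 'X^((c (i + d%:Z)).-1) * continuant d i).
Proof.
elim: d => [|d IH].
  rewrite /Mq big_seq1 continuantSS !continuant0 !continuant1 !mulr0 oppr0 !addr0 !mulr1.
  by congr mat2; congr (qint (c _)); lia.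
rewrite mkseqS /Mq big_rcons /= -/(Mq _) IH mat2_mul.
rewrite [continuant d.+3 _]continuantSS [continuant d.+2 i]continuantSS.
have -> : i - 1 + d.+2%:Z = i + d.+1%:Z by lia.
have -> : i - 1 + d.+1%:Z = i + d%:Z by lia.
by congr mat2; ring.
Qed.

(** The divisors met in computing row d have lengths 1, ..., d - 2; once they are nonzero, the
    unimodular rule has a unique solution. *)
Lemma frieze_row_continuant d k :
  (forall m k, (0 < m)%N -> (m.+2 <= d)%N -> continuant m k != 0) ->
  frieze_row c d k = toQq (continuant d k).
Proof.
have [m] := ubnP d; elim: m d k => // m IH [|[|[|d]]] k hd nz.
- by rewrite raddf0.
- by rewrite rmorph1.
- by rewrite continuantSS continuant0 continuant1 mulr0 subr0 mulr1.
have nz' e : (e <= d.+3)%N ->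
    forall m k, (0 < m)%N -> (m.+2 <= e)%N -> continuant m k != 0.
  by move=> he m' k' m0 me; apply: nz => //; apply: leq_trans he.
have -> : frieze_row c d.+3 k =
    (frieze_row c d.+2 k * frieze_row c d.+2 (k + 1)
       - toQq 'X^(\sum_(m < d.+1) (c (k + 1 + m%:Z)%R).-1))
    / frieze_row c d.+1 (k + 1) by [].
rewrite !IH; try by [lia | apply: nz'; lia].
have nz1 : toQq (continuant d.+1 (k + 1)) != 0 by rewrite toQq_eq0 nz.
apply: (mulIf nz1); rewrite divfK // -continuant_unimodular -!rmorphM -rmorphB.
by congr toQq; ring.
Qed.

(** The numerator, of length d + 1, is allowed to vanish, as happens when the window has n - 1
    coefficients. *)
Lemma qcf_continuant d i :
  (forall m k, (0 < m)%N -> (m <= d)%N -> continuant m k != 0) ->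
  qcf (mkseq (fun m => c (i + m%:Z)) d) =
  P1_ratio (toQq (continuant d.+1 (i - 1))) (toQq (continuant d i)).
Proof.
elim: d i => [|d IH] i nz; first by rewrite /P1_ratio continuant0 raddf0 eqxx.
have nzd k : toQq (continuant d.+1 k) != 0 by rewrite toQq_eq0 nz.
case: d IH nz nzd => [|d] IH nz nzd.
  rewrite /P1_ratio (negPf (nzd _)) continuantSS continuant0 !continuant1.
  rewrite (rmorph1 toQq) divr1 mulr0 subr0 mulr1.
  by congr (Some (toQq (qint (c _)))); lia.
have shift : mkseq (fun m => c (i + m%:Z)) d.+2 =
    c i :: mkseq (fun m => c (i + 1 + m%:Z)) d.+1.
  rewrite -[d.+2]/(1 + d.+1)%N mkseqD [mkseq _ 1]/= cat1s addr0; congr (_ :: _).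
  by apply: eq_mkseq => m; congr c; lia.
have -> : qcf (mkseq (fun m => c (i + m%:Z)) d.+2) =
    P1_sub_div (toQq (qint (c i))) (toQq 'X^((c i).-1))
      (qcf (mkseq (fun m => c (i + 1 + m%:Z)) d.+1)) by rewrite shift.
rewrite IH; last by move=> m k m0 md; apply: nz => //; apply: leqW.
have nz1 : toQq (continuant d.+1 (i + 1)) != 0 by rewrite toQq_eq0 nz.
(* The tail is a quotient of nonzero continuants, so neither infinity nor division by zero
   occurs. *)
rewrite addrK /P1_ratio (negPf nz1) (negPf (nzd _)) /= mulf_eq0 invr_eq0.
rewrite (negPf nz1) orbF (negPf (nzd _)) [continuant d.+3 _]continuant_recl.
have -> : i - 1 + 1 = i by lia.
have -> : i - 1 + 2 = i + 1 by lia.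
move: nz1 (nzd i); move: (continuant d.+1 _) (continuant d.+2 _) => K' K K'0 K0.
congr Some; rewrite (rmorphB toQq) !(rmorphM toQq) mulrBl mulfK // invf_div.
by rewrite mulrA.
Qed.

End Continuants.

Lemma eq_continuant c c' k k' :
  (forall m : nat, c (k + m%:Z) = c' (k' + m%:Z)) ->
  forall d, continuant c d k = continuant c' d k'.
Proof.
move=> E d; have [m] := ubnP d; elim: m d => // m IH [|[|d]] hd //.
by rewrite !continuantSS !E !IH //; lia.
Qed.

Lemma prod_nat_ends (R : pzSemiRingType) m (G : nat -> R) : (1 < m)%N ->
  \prod_(0 <= i < m) G i = G 0%N * (\prod_(1 <= i < m.-1) G i) * G m.-1.
Proof. by case: m => [|[|m]] // _; rewrite big_nat_recr // big_ltn. Qed.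

(** * Which continuants of a quiddity vanish *)

Section QuiddityContinuants.

Variables (n : nat) (T : {set 'I_n * 'I_n}).
Hypotheses (hn : (3 <= n)%N) (hT : is_triangulation T).

Local Notation c := (quiddity T).
Local Notation K := (continuant c).
Local Notation q := (toQq 'X).

Lemma eq_quiddity u v : (u = v %[mod n%:Z])%Z -> c u = c v.
Proof. by move=> E; rewrite /quiddity E. Qed.

Lemma eq_quiddityD i j u : (i = j %[mod n%:Z])%Z -> c (i + u) = c (j + u).
Proof. by move=> E; apply: eq_quiddity; rewrite -modzDml E modzDml. Qed.

Lemma modz_ex (i : int) : exists2 k : nat, (k < n)%N & (i = k%:Z %[mod n%:Z])%Z.
Proof.
exists `|(i %% n%:Z)%Z|%N; last by rewrite gez0_abs ?modz_ge0 ?modz_mod; lia.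
by have := @ltz_pmod i n%:Z; have := @modz_ge0 i n%:Z; lia.
Qed.

(** Ensures that the exponents c_u - 1 are not truncated, so that the factors of [Mq] become [qmat]
    over Q(q). *)
Lemma quiddity_gt0 u : (0 < c u)%N.
Proof.
have [k kn /eq_quiddity->] := modz_ex u.
rewrite quiddity_cell_count //.
by apply: (cell_count_gt0 hn hT); [apply: edge0; lia|lia|lia].
Qed.

Let q0 : q != 0.
Proof. by rewrite toQq_eq0 polyX_eq0. Qed.

Let W (i : int) (d : nat) : 'M[Qq]_2 :=
  map_mx toQq (Mq (mkseq (fun m => c (i + m%:Z)) d)).

Let W_prod i d : W i d = \prod_(0 <= m < d) qmat q (c (i + m%:Z)).
Proof.
rewrite /W /Mq rmorph_prod big_map /index_iota subn0; apply: eq_bigr => m _ /=.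
have := quiddity_gt0 (i + m%:Z); case: (c _) => // e _.
rewrite map_mat2 /qmat rmorph0 rmorph1 rmorphN rmorphXn /= exprSr mulfK //.
by congr mat2; rewrite rmorph_sum /=; apply: eq_bigr => k _; rewrite rmorphXn.
Qed.

Let W_cat i d e : W i (d + e) = W i d * W (i + d%:Z) e.
Proof.
rewrite /W mkseqD /Mq big_cat /= rmorphM; congr (_ * map_mx _ (\prod_(a <- _) _)).
by apply: eq_mkseq => m; congr c; lia.
Qed.

Let eq_W i j d : (i = j %[mod n%:Z])%Z -> W i d = W j d.
Proof.
by move=> E; rewrite !W_prod; apply: eq_bigr => m _; rewrite (eq_quiddityD _ E).
Qed.

Let W_continuant i d : W (i + 1) d.+1 =
  mat2 (toQq (K d.+2 i)) (- q ^+ (c (i + 1 + d%:Z)).-1 * toQq (K d.+1 i))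
    (toQq (K d.+1 (i + 1))) (- q ^+ (c (i + 1 + d%:Z)).-1 * toQq (K d (i + 1))).
Proof.
rewrite /W Mq_continuant map_mat2 addrK.
by rewrite !(rmorphM toQq) !(rmorphN toQq) !(rmorphXn toQq).
Qed.

(** For i = 0 this is [monodromy_scalar] on the closing side. Another start rotates the product, and
    a one-sided inverse of a square matrix is two-sided, so the scalar stays the same. *)
Let W_scalar i : exists2 s : Qq, s != 0 & W i n = s%:M.
Proof.
have [k kn /eq_W->] := modz_ex i.
have [|s s0 E] := monodromy_scalar hn hT q0 (edge0 T _); first by lia.
have W0 : W 0 n = s%:M.
  rewrite -E W_prod prod_nat_ends; last by lia.
  congr (_ * _ * _); try by rewrite -quiddity_cell_count ?add0r //; lia.
  by apply: eq_big_nat => m mn; rewrite -quiddity_cell_count ?add0r //; lia.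
exists s => //.
have nE : n = (k + (n - k))%N by lia.
have A : W 0 k * (s^-1 *: W k (n - k)) = 1.
  rewrite -scalerAr -[W k _]/(W (0 + k%:Z) _) -W_cat subnKC; last exact: ltnW.
  by rewrite W0 scale_scalar_mx mulVf.
rewrite {1}nE addnC W_cat.
have -> : W (k%:Z + (n - k)%:Z) k = W 0 k.
  by apply: eq_W; rewrite (_ : _ + _ = n%:Z) ?modzz ?mod0z //; lia.
have := mulmx1C A; rewrite -[_ *m _]/(_ * _) -scalerAl => B.
by rewrite -[LHS](scalerKV s0) B scalemx1.
Qed.

(** Up to a unit, this is the upper right entry of a scalar matrix. *)
Lemma continuant_vanishes k : K n k = 0.
Proof.
have [s s0] := W_scalar (k + 1).
have := W_continuant k n.-1; rewrite prednK; last by lia.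
move=> -> E; rewrite mat2_scalar in E; have [_ + _ _] := mat2_inj E.
move/eqP; rewrite mulf_eq0 oppr_eq0 expf_eq0 (negPf q0) andbF /= toQq_eq0.
by move/eqP.
Qed.

(** At q = 1 the labels f satisfy the same recurrence, and f(k+e) K_(e+1) = f(k+e+1) K_e + f(k)
    propagates positivity as long as k + e + 1 stays within 0, ..., n - 1. *)
Lemma continuant_gt0 (k d : nat) : (0 < d)%N -> (k + d < n)%N ->
  0 < (K d k%:Z).[1].
Proof.
move=> d0 kd.
have [|f [_ _ fgt0 frec]] := positive_labels hn hT (edge0 T _) ltr01 ltr01; first by lia.
(* The Wronskian of f and of the continuants K _ k is constant. *)
have wronskian e : (k + e.+1 < n)%N ->
    f (k + e)%N * (K e.+1 k%:Z).[1] = f (k + e.+1)%N * (K e k%:Z).[1] + f k.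
  elim: e => [|e IH] ke; first by rewrite continuant0 continuant1 !hornerE.
  have qint1 a : (qint a).[1] = a%:Z.
    rewrite /qint horner_sum (eq_bigr (fun=> 1)) => [|m _]; last by rewrite hornerXn expr1n.
    by rewrite sumr_const card_ord natz.
  rewrite continuantSS -!PoszD !hornerE qint1 expr1n mul1r quiddity_cell_count //; last by lia.
  have -> : f k = f (k + e)%N * (K e.+1 k%:Z).[1] - f (k + e.+1)%N * (K e k%:Z).[1].
    by rewrite IH; [ring|lia].
  have := frec (k + e)%N; rewrite -!addnS => ->; [ring|lia|lia].
have pos e : (k + e.+1 < n)%N -> 0 < (K e.+1 k%:Z).[1].
  elim: e => [|e IH] ke; first by rewrite continuant1 hornerE.
  have f0 : 0 < f (k + e.+1)%N by apply: fgt0; lia.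
  rewrite -(pmulr_rgt0 _ f0) wronskian //.
  by rewrite addr_gt0 ?mulr_gt0 ?fgt0 ?IH //; lia.
by rewrite -(prednK d0); apply: pos; rewrite prednK.
Qed.

Lemma continuant_neq0 d i : (0 < d)%N -> (d < n)%N -> K d i != 0.
Proof.
move=> d0 dn; have [k kn E] := modz_ex i.
rewrite (eq_continuant (k' := k%:Z) (c' := c)); last by move=> m; apply: eq_quiddityD.
have nz (l e : nat) : (0 < e)%N -> (l + e < n)%N -> K e l%:Z != 0.
  move=> e0 le; apply: contraTneq (continuant_gt0 e0 le) => ->.
  by rewrite horner0 ltxx.
case: (ltnP (k + d) n) => [|nkd]; first exact: nz.
(* Glide symmetry: up to a unit, K d k is K (k - u) u where u = k + d - n. *)
pose u := (k + d - n)%N.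
have [s s0] := W_scalar (u%:Z + 1).
have nE : ((k - u).-1.+1 + d.-1.+1)%N = n by lia.
have := W_cat (u%:Z + 1) (k - u).-1.+1 d.-1.+1; rewrite nE => ->.
have -> : u%:Z + 1 + (k - u).-1.+1%:Z = k%:Z + 1 by lia.
(* The complementary window has length k - u = n - d and does not wrap around: u + (k - u) = k <
   n. *)
have : toQq (K (k - u).-1.+1 u%:Z) != 0 by rewrite toQq_eq0 nz; lia.
rewrite !W_continuant mat2_mul mat2_scalar => nzA E'; have [_ E01 _ E11] := mat2_inj E'.
(* If K d k vanished, the upper right entry of the scalar product would force the lower right entry
   of the second factor to vanish, and with it s. *)
apply/negP => /eqP; rewrite -{1}(prednK d0) => Kd0.
move: E01 E11; rewrite Kd0 (rmorph0 toQq) !(mulr0, add0r).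
move=> /eqP; rewrite mulf_eq0 mulf_eq0 oppr_eq0 expf_eq0 (negPf q0) andbF (negPf nzA) /=.
by move=> /eqP-> /esym/eqP; rewrite mulr0 (negPf s0).
Qed.

End QuiddityContinuants.

(** * The frieze of a triangulation through its continuants *)

(** For d <= n + 1 the divisors have lengths 1, ..., n - 1, the range of [continuant_neq0]. *)
Lemma zeta_continuant (n : nat) (T : {set 'I_n * 'I_n}) (k l : int) (d : nat) :
  (3 <= n)%N -> is_triangulation T -> (d <= n.+1)%N -> l = k + d%:Z ->
  zeta (quiddity T) k l = toQq (continuant (quiddity T) d k).
Proof.
move=> hn hT dn ->; rewrite /zeta addrAC subrr add0r.
apply: frieze_row_continuant => m i m0 md.
by apply: continuant_neq0 => //; lia.
Qed.

Theorem proposition3p6 (n : nat) (hn : (3 <= n)%N)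
    (T : {set 'I_n * 'I_n}) (hT : is_triangulation T) :
  let c := quiddity T in
  (* the frieze is well defined, with entries in Z[q] *)
  [/\ (forall k l : int, 3 <= l - k <= n%:Z + 1 ->
         zeta c (k + 1) (l - 1) != 0),
      (forall k l : int, 0 <= l - k <= n%:Z + 1 ->
         exists p : {poly int}, zeta c k l = toQq p)
    & forall i j : int, i <= j -> j <= i + n%:Z - 2 ->
      exists R R' S S' : {poly int},
      [/\ Mq (window c i j)
            = mat2 R (- 'X^((c j).-1) * R') S (- 'X^((c j).-1) * S'),
          [/\ mat2 (zeta c (i - 1) (j + 1)) (zeta c (i - 1) j)
                   (zeta c i (j + 1)) (zeta c i j)
                = mat2 (toQq R) (toQq R') (toQq S) (toQq S'),
              (if j == i then zeta c i j = 0 /\ S' = 0 else S' != 0),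
              (if j == i + n%:Z - 2
               then zeta c (i - 1) (j + 1) = 0 /\ R = 0 else R != 0),
              R' != 0
            & S != 0]
        &
          qcf (window c i (j - 1)) = P1_ratio (toQq R') (toQq S')
          /\ qcf (window c i j) = P1_ratio (toQq R) (toQq S)]].
Proof.
move=> c; have zetaE k l d := @zeta_continuant n T k l d hn hT.
have nz d k : (0 < d)%N -> (d < n)%N -> continuant c d k != 0.
  exact: continuant_neq0.
split=> [k l kl|k l kl|i j ij jn].
- by rewrite (@zetaE _ _ `|(l - k - 2)%R|%N) ?toQq_eq0 ?nz //; lia.
- by exists (continuant c `|(l - k)%R|%N k); apply: zetaE; lia.
pose d := `|(j - i)%R|%N; have jE : j = i + d%:Z by lia.
have winE e : window c i (i + e%:Z - 1) = mkseq (fun m => c (i + m%:Z)) e.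
  by rewrite /window; congr mkseq; lia.
have -> : window c i j = mkseq (fun m => c (i + m%:Z)) d.+1.
  by rewrite -winE; congr window; lia.
rewrite jE winE -jE.
(* The witnesses are read off from [Mq_continuant]. Their lengths d + 2, d + 1, d + 1, d lie between
   0 and n, and the extremes 0 and n are the two vanishing cases. *)
exists (continuant c d.+2 (i - 1)), (continuant c d.+1 (i - 1)).
exists (continuant c d.+1 i), (continuant c d i).
split.
- by rewrite Mq_continuant -jE.
- have z1 : zeta c (i - 1) (j + 1) = toQq (continuant c d.+2 (i - 1)).
    by apply: zetaE; lia.
  have z2 : zeta c i j = toQq (continuant c d i) by apply: zetaE; lia.
  split; try by apply: nz; lia.
  + by rewrite z1 z2; congr mat2; apply: zetaE; lia.
  + case: eqP => [ji|ji]; last by apply: nz; lia.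
    have d0 : d = 0%N by lia.
    by rewrite z2 d0 continuant0 rmorph0.
  case: eqP => [ji|ji]; last by apply: nz; lia.
  have dn : d.+2 = n by lia.
  by rewrite z1 dn continuant_vanishes // rmorph0.
by split; apply: qcf_continuant => m k m0 md; apply: nz; lia.
Qed.
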